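(* Let $X$ be a complex topological vector space and let $\Gamma\subset\mathcal{B}(X)$. If $\Gamma$ is diskcyclic transitive, then it is disk transitive.
   Context: $\mathcal{B}(X)$ is the set of all continuous linear operators on $X$, and $\mathbb{D}=\{\alpha\in\mathbb{C}:|\alpha|\le 1\}$. A vector $x\in X$ is a diskcyclic vector for $\Gamma$ if $\{\alpha Tx:\alpha\in\mathbb{D},\,T\in\Gamma\}$ is dense in $X$; $\mathbb{D}C(\Gamma)$ is the set of all diskcyclic vectors for $\Gamma$. $\Gamma$ is diskcyclic transitive if $\mathbb{D}C(\Gamma)=X\setminus\{0\}$. $\Gamma$ is disk transitive if for any pair $(U,V)$ of nonempty open subsets of $X$ there exist $\alpha\in\mathbb{D}\setminus\{0\}$ and $T\in\Gamma$ such that $T(\alpha U)\cap V\neq\emptyset$.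
   Formalization: Γ is additionally assumed nonempty: for X = {0} and Γ = ∅ the claim as stated fails, since 𝔻C(Γ) = ∅ = X∖{0} while no T ∈ Γ exists; for X ≠ {0} diskcyclic transitivity already forces Γ to be nonempty. *)

(* Defs.v *)
From HB Require Import structures.
From mathcomp Require Import all_boot all_order all_algebra.
From mathcomp Require Import all_classical all_reals all_analysis.
From mathcomp Require Import complex.

Set Implicit Arguments.
Unset Strict Implicit.
Unset Printing Implicit Defensive.

Import Order.TTheory GRing.Theory Num.Theory.

Local Open Scope classical_set_scope.
Local Open Scope ring_scope.

(* A complex topological vector space is a [topologicalLmodType R[i]] with
   [R : realType]. The library's [tvsType] is not used since it is moreover
   locally convex; the Hausdorff property is not assumed. *)

Definition continuous_operators (R : realType) (X : topologicalLmodType R[i]) :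
    set {linear X -> X} :=
  [set T : {linear X -> X} | continuous T].
Arguments continuous_operators {R} X.

(* [`|alpha|] is the complex modulus, as an element of [R[i]]; comparing it
   with 1 is the usual comparison of reals. *)
Definition unit_disk (R : realType) : set R[i] :=
  [set alpha : R[i] | `|alpha| <= 1].
Arguments unit_disk : clear implicits.

Definition disk_orbit (R : realType) (X : topologicalLmodType R[i])
    (Gamma : set {linear X -> X}) (x : X) : set X :=
  [set y : X | exists alpha : R[i], exists T : {linear X -> X},
     [/\ unit_disk R alpha, Gamma T & y = alpha *: T x]].

Definition diskcyclic_vectors (R : realType) (X : topologicalLmodType R[i])
    (Gamma : set {linear X -> X}) : set X :=
  [set x : X | dense (disk_orbit Gamma x)].

Definition diskcyclic_transitive (R : realType) (X : topologicalLmodType R[i])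
    (Gamma : set {linear X -> X}) : Prop :=
  diskcyclic_vectors Gamma = [set: X] `\ 0.

Definition disk_transitive (R : realType) (X : topologicalLmodType R[i])
    (Gamma : set {linear X -> X}) : Prop :=
  forall U V : set X, open U -> open V -> U !=set0 -> V !=set0 ->
    exists alpha : R[i], exists T : {linear X -> X},
      [/\ (unit_disk R `\ 0) alpha, Gamma T &
          (T @` ((fun x : X => alpha *: x) @` U)) `&` V !=set0].

(* Main.v *)
Require Import Defs.
From HB Require Import structures.
From mathcomp Require Import all_boot all_order all_algebra.
From mathcomp Require Import all_classical all_reals all_analysis.
From mathcomp Require Import complex.

Import Order.TTheory GRing.Theory Num.Theory.

Local Open Scope classical_set_scope.
Local Open Scope ring_scope.

(** If U contains x <> 0, density of the disk orbit of x gives alpha *: T x in V;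
    when alpha = 0 this says 0 \in V, and then a small nonzero multiple of T x
    lies in V as well. If U contains 0, it contains a nonzero multiple of any
    v \in V, so the only remaining case is 0 \in U and 0 \in V, where T 0 = 0. *)

(** Scaling is jointly continuous at [(0, v)], where its value is 0, so every scalar close enough to
    0 carries [v] into [W]. *)
Lemma open0_small_scale (K : numFieldType) (X : topologicalLmodType K)
    (W : set X) (v : X) :
  open W -> W 0 -> exists a : K, [/\ a != 0, `|a| <= 1 & W (a *: v)].
Proof.
move=> oW W0.
have : nbhs ((0 : K^o) *: v) W by rewrite scale0r; exact: open_nbhs_nbhs.
move/(@scale_continuous K X (0, v)) => [[A B] /= [nA nB] AB].
have [e /= e0 Ae] := (nbhs_ballP (0 : K^o) A).1 nA.
(* [e / (e + 1)] is positive and lies below both [e] and 1, which meets all the bounds without a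
   minimum. *)
have e1 : 0 < e + 1 by rewrite addr_gt0.
have a0 : 0 < e / (e + 1) by rewrite divr_gt0.
exists (e / (e + 1)); split; first exact: lt0r_neq0.
  by rewrite gtr0_norm// ler_pdivrMr// mul1r lerDl.
apply: (AB (_, v)); split => /=; last exact: nbhs_singleton.
apply: Ae; rewrite /ball/= sub0r normrN gtr0_norm//.
by rewrite ltr_pdivrMr// mulrDr mulr1 ltrDr mulr_gt0.
Qed.

Arguments open0_small_scale {K X W} v.

Theorem proposition3p15 (R : realType) (X : topologicalLmodType R[i])
    (Gamma : set {linear X -> X})
    (Gamma_sub : Gamma `<=` continuous_operators X)
    (Gamma_neq0 : Gamma !=set0) :
  diskcyclic_transitive Gamma -> disk_transitive Gamma.
Proof.
move=> DC U V oU oV [u Uu] [v Vv].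
suff [a [T [a0 a1 GT [x Ux Vx]]]] : exists (a : R[i]) (T : {linear X -> X}),
    [/\ a != 0, `|a| <= 1, Gamma T & exists2 x, U x & V (a *: T x)].
  exists a, T; split => //; first by split => //; exact/eqP.
  exists (a *: T x); split => //.
  by exists (a *: x); [exists x | rewrite linearZ].
have [[x [Ux x0]]|U0] := pselect (exists x, U x /\ x != 0).
  have /(_ V)[] : dense (disk_orbit Gamma x).
    suff : diskcyclic_vectors Gamma x by [].
    by rewrite DC; split => //; exact/eqP.
  - by exists v.
  - exact: oV.
  move=> y [Vy [a [T [a1 GT yE]]]]; rewrite {}yE in Vy.
  have [a0|a0] := eqVneq a 0; last by exists a, T; split => //; exists x.
  have V0 : V 0 by move: Vy; rewrite a0 scale0r.
  have [b [b0 b1 Vb]] := open0_small_scale (T x) oV V0.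
  by exists b, T; split => //; exists x.
have {}U0 x : U x -> x = 0.
  by move=> Ux; have [//|x0] := eqVneq x 0; case: U0; exists x.
have u0 := U0 _ Uu; rewrite {}u0 in Uu.
(* Here [U] is reduced to 0, so the nonzero multiple of [v] found in it vanishes, forcing
   [v = 0]. *)
have [b [b0 _ /U0/eqP]] := open0_small_scale v oU Uu.
rewrite scaler_eq0 (negPf b0) => /eqP v0.
(* The only use of [Gamma_neq0]: if [X] is zero and [Gamma] is empty, diskcyclic transitivity holds
   while disk transitivity fails. *)
have [T GT] := Gamma_neq0.
exists 1, T; split; rewrite ?oner_eq0 ?normr1//.
by exists 0 => //; rewrite linear0 scaler0 -v0.
Qed.
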